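(* Let $q$ be a prime power, $\lambda$ a nontrivial additive character of $\mathbb{F}_q$, and $x,y\in\mathbb{F}_q^*$. Then, as formal power series in $u$, \[ 1+\sum_{n=1}^{\infty}\frac{u^n}{|GL(n,q)|}\sum_{g\in GL(n,q)}\lambda\big(x\operatorname{tr}(g)+y\operatorname{tr}(g^{-1})\big) = \prod_{i\ge 1}\left(1+\frac{u\,K_\lambda(x,y)}{q^i}+\frac{q\,u^2}{q^{2i}}\right). \]
   Context: $GL(n,q)$ is the group of invertible $n\times n$ matrices over $\mathbb{F}_q$, and $K_\lambda(x,y)=\sum_{\alpha\in\mathbb{F}_q^*}\lambda(x\alpha+y/\alpha)$. *)

(* Defs.v *)
From HB Require Import structures.
From mathcomp Require Import all_boot all_order all_algebra all_field.
From mathcomp Require Import all_classical all_reals all_analysis.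
Set Implicit Arguments. Unset Strict Implicit. Unset Printing Implicit Defensive.
Import Order.TTheory GRing.Theory Num.Theory.
Import numFieldNormedType.Exports.
Local Open Scope ring_scope.

Definition additive_character (F : finFieldType) (lam : F -> algC) : Prop :=
  lam 0 = 1 /\ forall a b : F, lam (a + b) = lam a * lam b.

Definition nontrivial_character (F : finFieldType) (lam : F -> algC) : Prop :=
  exists a : F, lam a != 1.

Definition kloosterman (F : finFieldType) (lam : F -> algC) (x y : F) : algC :=
  \sum_(a : F | a != 0) lam (x * a + y / a).

Definition GL_card (F : finFieldType) (n : nat) : nat :=
  #|[set g : 'M[F]_n | g \in unitmx]|.

Definition lhs_coef (F : finFieldType) (lam : F -> algC) (x y : F) (n : nat) : algC :=
  if n is 0 then 1 else
  (GL_card F n)%:R^-1 *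
    \sum_(g : 'M[F]_n | g \in unitmx) lam (x * \tr g + y * \tr (invmx g)).

Definition trunc_prod (F : finFieldType) (lam : F -> algC) (x y : F) (N : nat) : {poly algC} :=
  let q : algC := (#|F|)%:R in
  \prod_(1 <= i < N.+1)
     (1 + (kloosterman lam x y / q ^+ i) *: 'X + (q / q ^+ (2 * i)) *: 'X ^+ 2).

(* Main.v *)
(* Let S_n be the sum over GL(n, q) of the class function
   w(g) = lam (x tr g + y tr g^-1).  Averaging w over the unipotent matrices u
   fixing e_1 and acting trivially on F^n / <e_1> shows that only the g with
   x g e_1 - y g^-1 e_1 in <e_1> contribute.  If g e_1 lies in <e_1>, then g is
   block triangular, which gives q^(n-1) K S_(n-1).  Otherwise the span of e_1
   and g e_1 is a g-stable plane on which g has determinant - y / x, so that the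
   plane contributes w = 1; this gives q^(2n-2) (q^(n-1) - 1) S_(n-2).  On the
   other side, the partial products P_N(u) satisfy
   (1 + u K / q^N + q u^2 / q^(2N)) P_N(q u) = (1 + u K + q u^2) P_N(u),
   whose coefficients converge to the same recurrence as N tends to infinity. *)
Require Import Defs.
From HB Require Import structures.
From mathcomp Require Import all_boot all_order all_algebra all_field.
From mathcomp Require Import all_classical all_reals all_analysis.
From mathcomp Require Import ring.
Set Implicit Arguments. Unset Strict Implicit. Unset Printing Implicit Defensive.
Import Order.TTheory GRing.Theory Num.Theory.
Import numFieldNormedType.Exports.
Local Open Scope classical_set_scope.
Local Open Scope ring_scope.

(** * The order of GL(n, q) *)

Lemma card_field_neq0 (F : finFieldType) : #|F|%:R != 0 :> algC.
Proof. by rewrite pnatr_eq0 -lt0n ltnW // finNzRing_gt1. Qed.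

Lemma card_field_pow_sub1_neq0 (F : finFieldType) n : #|F|%:R ^+ n.+1 - 1 != 0 :> algC.
Proof. by rewrite subr_eq0 gt_eqF // exprn_egt1 // ltr1n finNzRing_gt1. Qed.

Lemma GL_card0 (F : finFieldType) : GL_card F 0 = 1%N.
Proof.
rewrite /GL_card -[RHS](cards1 (0 : 'M[F]_0)); apply: eq_card => g.
by rewrite !inE unitmxE det_mx00 unitr1 [g]flatmx0 eqxx.
Qed.

Lemma GL_card_rec (F : finFieldType) n :
  GL_card F n.+1 = (#|F| ^ n * (#|F| ^ n.+1 - 1) * GL_card F n)%N.
Proof.
(* The closed formula for the order, extended to size 0; the recurrence then follows from Pascal's
   rule for the exponent of q. *)
have cardE m : GL_card F m = (#|F| ^ 'C(m, 2) * \prod_(1 <= i < m.+1) (#|F| ^ i - 1))%N.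
  case: m => [|m]; first by rewrite GL_card0 big_geq.
  rewrite -card_GL // /GL_card -(card_imset _ (@val_inj _ _ {'GL_m.+1[F]})).
  apply: eq_card => g; rewrite !inE; apply/idP/imsetP => [ug|[u _ ->]].
    by exists (Sub g ug : {'GL_m.+1[F]}).
  exact: valP.
by rewrite !cardE big_nat_recr //= binS bin1 expnD; ring.
Qed.

Lemma GL_card_recR (F : finFieldType) n : (GL_card F n.+1)%:R =
  #|F|%:R ^+ n * (#|F|%:R ^+ n.+1 - 1) * (GL_card F n)%:R :> algC.
Proof.
by rewrite GL_card_rec !natrM natrB ?natrX // expn_gt0 ltnW // finNzRing_gt1.
Qed.

Lemma GL_card_neq0 (F : finFieldType) n : (GL_card F n)%:R != 0 :> algC.
Proof.
elim: n => [|n IH]; first by rewrite GL_card0 oner_eq0.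
by rewrite GL_card_recR !mulf_neq0 ?expf_neq0 ?card_field_neq0 ?card_field_pow_sub1_neq0.
Qed.

(** * Block matrices and pivoting *)

Lemma big_block_mx (F : finFieldType) (V : nmodType) k m
    (P : pred 'M[F]_(k + m)) (f : 'M[F]_(k + m) -> V) :
  \sum_(g | P g) f g =
  \sum_(A : 'M[F]_k) \sum_(C : 'M[F]_(m, k)) \sum_(B : 'M[F]_(k, m))
    \sum_(D : 'M[F]_m | P (block_mx A B C D)) f (block_mx A B C D).
Proof.
apply: esym; under eq_bigr do under eq_bigr do rewrite pair_big_dep.
under eq_bigr do rewrite pair_big_dep.
rewrite pair_big_dep /= [RHS](reindex (fun p :
  'M[F]_k * ('M[F]_(m, k) * ('M[F]_(k, m) * 'M[F]_m)) =>
  block_mx p.1 p.2.2.1 p.2.1 p.2.2.2)) //=.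
exists (fun g : 'M[F]_(k + m) => (ulsubmx g, (dlsubmx g, (ursubmx g, drsubmx g)))).
  by move=> [A [C [B D]]] _ /=; rewrite block_mxKul block_mxKur block_mxKdl block_mxKdr.
by move=> g _ /=; rewrite submxK.
Qed.

Lemma invmx_right_inv (F : fieldType) n (A B : 'M[F]_n) : A *m B = 1%:M -> invmx A = B.
Proof.
move=> AB; have [uA _] := mulmx1_unit AB.
by rewrite -[LHS]mulmx1 -AB mulmxA mulVmx // mul1mx.
Qed.

Lemma invmx_ublock (F : fieldType) k m (A : 'M[F]_k) B (D : 'M[F]_m) :
  A \in unitmx -> D \in unitmx ->
  invmx (block_mx A B 0 D) = block_mx (invmx A) (- (invmx A *m B *m invmx D)) 0 (invmx D).
Proof.
move=> uA uD; apply: invmx_right_inv.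
rewrite mulmx_block !mulmx0 !mul0mx !addr0 !add0r !mulmxV //.
by rewrite mulmxN !mulmxA mulmxV // mul1mx addNr -scalar_mx_block.
Qed.

Lemma ublock_unitmx (F : fieldType) k m (A : 'M[F]_k) B (D : 'M[F]_m) :
  (block_mx A B 0 D \in unitmx) = (A \in unitmx) && (D \in unitmx).
Proof. by rewrite !unitmxE det_ublock unitrM. Qed.

(** Links the splittings 2 + m and 1 + (1 + m) of the same index set: both sides are the first
    column without its top entry. *)
Lemma dlsubmx_block_mx2 (F : fieldType) m (A : 'M[F]_2) B (C : 'M[F]_(m, 2)) D :
  dlsubmx (block_mx A B C D : 'M[F]_(1 + (1 + m))) = col_mx (A 1 0)%:M (col 0 C).
Proof.
apply/colP => i; rewrite [RHS]mxE; case: (split_ordP i) => j -> /=.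
  transitivity (block_mx A B C D (lshift m 1) (lshift m 0)).
    by rewrite /dlsubmx /lsubmx /dsubmx mxE [LHS]mxE; congr (fun_of_matrix _ _ _);
      apply: val_inj; rewrite //= ord1.
  by rewrite block_mxEul mxE ord1 mulr1n.
transitivity (block_mx A B C D (rshift 2 j) (lshift m 0)).
  by rewrite /dlsubmx /lsubmx /dsubmx mxE [LHS]mxE; congr (fun_of_matrix _ _ _); apply: val_inj.
by rewrite block_mxEdl mxE.
Qed.

(** A nonzero column has rank 1, so its rank decomposition is an invertible matrix times the first
    basis vector times a nonzero scalar [r]. *)
Lemma col_pivot (F : fieldType) n (c : 'cV[F]_(1 + n)) : c != 0 ->
  exists2 P : 'M[F]_(1 + n), P \in unitmx & P *m c = col_mx 1%:M 0.
Proof.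
move=> c0; have rc : \rank c = 1%N.
  by apply/eqP; rewrite eqn_leq rank_leq_col lt0n mxrank_eq0.
set r := row_ebase c 0 0.
have rE : row_ebase c = r%:M by rewrite [LHS]mx11_scalar.
have r0 : r != 0.
  by have := row_ebase_unit c; rewrite unitmxE rE det_scalar1 unitfE.
have := mulmx_ebase c; rewrite rc rE mul_mx_scalar pid_mx_col => cE.
exists (r^-1 *: invmx (col_ebase c)).
  by rewrite unitmxZ ?unitfE ?invr_eq0 // unitmx_inv col_ebase_unit.
rewrite -[in X in _ *m X]cE -scalemxAl -scalemxAr scalerA mulVf // scale1r.
by rewrite mulKmx // col_ebase_unit.
Qed.

(** * Two by two matrices *)

Lemma det_mx22 (R : comNzRingType) (A : 'M[R]_2) :
  \det A = A 0 0 * A 1 1 - A 0 1 * A 1 0.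
Proof.
rewrite (expand_det_row _ 0) !big_ord_recl big_ord0 /cofactor !det_mx11 !mxE addr0.
rewrite /= expr0 expr1 mul1r mulN1r mulrN.
by congr (A _ _ * A _ _ - A _ _ * A _ _); apply: val_inj.
Qed.

Lemma ord2P (i : 'I_2) : i = 0 \/ i = 1.
Proof. by case: i => -[|[|//]] ?; [left | right]; apply: val_inj. Qed.

Lemma mulmx22E (R : pzSemiRingType) m n (A : 'M[R]_(m, 2)) (B : 'M[R]_(2, n)) i j :
  (A *m B) i j = A i 0 * B 0 j + A i 1 * B 1 j.
Proof.
by rewrite mxE !big_ord_recl big_ord0 addr0; congr (_ + A _ _ * B _ _); apply: val_inj.
Qed.

(* Cayley-Hamilton in dimension 2. *)
Lemma invmx22 (F : fieldType) (A : 'M[F]_2) : \det A != 0 ->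
  invmx A = (\det A)^-1 *: ((\tr A)%:M - A).
Proof.
move=> dA; apply: invmx_right_inv.
have -> : 1%:M = (\det A)^-1 *: (\det A *: 1%:M) :> 'M[F]_2.
  by rewrite scalerA mulVf // scale1r.
rewrite -scalemxAr; congr (_ *: _).
have t2 : \tr A = A 0 0 + A 1 1.
  by rewrite /mxtrace !big_ord_recl big_ord0 addr0; congr (_ + A _ _); apply: val_inj.
rewrite mulmxBr mul_mx_scalar det_mx22 t2; apply/matrixP => i j.
transitivity ((A 0 0 + A 1 1) * A i j - (A *m A) i j); first by rewrite !mxE.
rewrite mulmx22E !mxE.
by have [->|->] := ord2P i; have [->|->] := ord2P j; rewrite /= ?mulr1n ?mulr0n; ring.
Qed.

Lemma mxtrace_invmx22 (F : fieldType) (A : 'M[F]_2) : \det A != 0 ->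
  \tr (invmx A) = \tr A / \det A.
Proof.
move=> dA; rewrite invmx22 // mxtraceZ linearB /= mxtrace_scalar mulrC.
by rewrite mulr2n addrK.
Qed.

(** * Character sums over GL(n, q) and their recurrence *)

Section GLsum.
Variables (F : finFieldType) (lam : F -> algC) (x y : F).
Hypotheses (lamP : additive_character lam) (lam_neq1 : nontrivial_character lam).
Hypotheses (x0 : x != 0) (y0 : y != 0).

Let lam0 : lam 0 = 1. Proof. by case: lamP. Qed.
Let lamD a b : lam (a + b) = lam a * lam b. Proof. by case: lamP. Qed.

Definition GL_weight n (g : 'M[F]_n) : algC := lam (x * \tr g + y * \tr (invmx g)).
Definition GL_sum n : algC := \sum_(g : 'M[F]_n | g \in unitmx) GL_weight g.
Notation q := (#|F|%:R : algC).

Let q0 : q != 0 := card_field_neq0 F.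

Lemma GL_weight_conj n (P g : 'M[F]_n) : P \in unitmx -> g \in unitmx ->
  GL_weight (P *m g *m invmx P) = GL_weight g.
Proof.
move=> uP ug; rewrite /GL_weight.
have -> : invmx (P *m g *m invmx P) = P *m invmx g *m invmx P.
  apply: invmx_right_inv.
  by rewrite !mulmxA mulmxKV // mulmxK // mulmxV.
by rewrite !(mxtrace_mulC _ (invmx P)) !mulmxA mulVmx // !mul1mx.
Qed.

Lemma GL_weight_ublock k m (A : 'M[F]_k) B (D : 'M[F]_m) :
  A \in unitmx -> D \in unitmx ->
  GL_weight (block_mx A B 0 D) = GL_weight A * GL_weight D.
Proof.
move=> uA uD; rewrite /GL_weight -lamD invmx_ublock // !mxtrace_block.
by congr lam; rewrite !mulrDr addrACA.
Qed.

Lemma sum_ublock k m (A : 'M[F]_k) : A \in unitmx ->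
  \sum_(B : 'M[F]_(k, m)) \sum_(D : 'M[F]_m | block_mx A B 0 D \in unitmx)
     GL_weight (block_mx A B 0 D) = q ^+ (k * m) * GL_weight A * GL_sum m.
Proof.
move=> uA.
under eq_bigr => B _.
  under eq_bigl do rewrite ublock_unitmx uA /=.
  under eq_bigr do rewrite GL_weight_ublock //.
  rewrite -mulr_sumr.
  over.
by rewrite sumr_const card_mx -[_ *+ _]mulr_natl natrX mulrA.
Qed.

(** Orthogonality of characters: if v is nonzero, some [w0] has [w0 *m v] equal to an [a] with
    [lam a != 1], and translation by [w0] multiplies the sum by [lam a]. *)
Lemma sum_char_row n (v : 'cV[F]_n) :
  \sum_(w : 'rV[F]_n) lam ((w *m v) 0 0) = if v == 0 then q ^+ n else 0.
Proof.
case: eqVneq => [->|v0].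
  under eq_bigr do rewrite mulmx0 mxE lam0.
  by rewrite sumr_const card_mx mul1n natrX.
have [a la] := lam_neq1.
have [i vi] : exists i, v i 0 != 0.
  apply/existsP; apply: contraNT v0 => /existsPn v0.
  by apply/eqP/colP => i; rewrite mxE; apply/eqP/negPn.
pose w0 : 'rV[F]_n := (a / v i 0) *: delta_mx 0 i.
have w0v : (w0 *m v) 0 0 = a.
  by rewrite -scalemxAl mxE -rowE mxE divfK.
set s := \sum_w _.
have : s = lam a * s.
  rewrite {1}/s (reindex_inj (addrI w0)) /= mulr_sumr.
  by apply: eq_bigr => w _; rewrite mulmxDl mxE lamD w0v.
move/eqP; rewrite -subr_eq0 -{1}(mul1r s) -mulrBl mulf_eq0 subr_eq0 eq_sym.
by rewrite (negPf la) => /eqP.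
Qed.

(** Right multiplication by [u w] permutes GL and adds w (x c - y c') to the argument of [lam],
    where c and c' are the lower left columns of g and its inverse. Summing over w kills every g
    with x c != y c'. *)
Lemma GL_sum_restrict n :
  GL_sum (1 + n) = \sum_(g : 'M[F]_(1 + n) |
     (g \in unitmx) && (x *: dlsubmx g == y *: dlsubmx (invmx g))) GL_weight g.
Proof.
apply: (@mulfI _ (q ^+ n)).
  by rewrite expf_neq0.
pose u (w : 'rV[F]_n) : 'M[F]_(1 + n) := block_mx 1%:M w 0 1%:M.
have uu w : u w \in unitmx by rewrite ublock_unitmx !unitmx1.
have uV w : invmx (u w) = u (- w).
  by rewrite invmx_ublock ?unitmx1 // !invmx1 mul1mx mulmx1.
have tru w (g : 'M[F]_(1 + n)) : \tr (g *m u w) = \tr g + (w *m dlsubmx g) 0 0.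
  rewrite -{1 2}[g]submxK mulmx_block !mxtrace_block !mulmx1 !mulmx0 !addr0.
  by rewrite mxtraceD mxtrace_mulC (trace_mx11 (w *m _)) addrCA [RHS]addrC.
have -> : q ^+ n * GL_sum (1 + n) = \sum_(w : 'rV[F]_n) GL_sum (1 + n).
  by rewrite sumr_const card_mx mul1n -natrX mulr_natl.
under eq_bigr => w _.
  rewrite /GL_sum (reindex_inj (can_inj (mulmxK (uu w)))) /=.
  under eq_bigl do rewrite unitmx_mul uu andbT.
  over.
rewrite exchange_big /= mulr_sumr [RHS]big_mkcondr; apply: eq_bigr => g ug.
transitivity (GL_weight g * \sum_(w : 'rV[F]_n)
   lam ((w *m (x *: dlsubmx g - y *: dlsubmx (invmx g))) 0 0)).
  rewrite mulr_sumr; apply: eq_bigr => w _.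
  rewrite /GL_weight -lamD; congr lam.
  have -> : invmx (g *m u w) = u (- w) *m invmx g.
    by apply: invmx_right_inv; rewrite -uV mulmxA mulmxK // mulmxV.
  rewrite [\tr (u _ *m _)]mxtrace_mulC !tru mulmxBr -!scalemxAr mulNmx !mxE.
  by ring.
by rewrite sum_char_row subr_eq0; case: ifP => _; rewrite ?mulr0 // mulrC.
Qed.

(** If g is block triangular, so is its inverse, and the restriction holds trivially. The 1 x 1
    corner runs over the units of F and yields the Kloosterman sum; the free row yields q^n. *)
Lemma GL_sum_parabolic n :
  \sum_(g : 'M[F]_(1 + n) | (g \in unitmx) &&
     (x *: dlsubmx g == y *: dlsubmx (invmx g)) && (dlsubmx g == 0)) GL_weight g
  = q ^+ n * kloosterman lam x y * GL_sum n.
Proof.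
transitivity (\sum_(g : 'M[F]_(1 + n) | (g \in unitmx) && (dlsubmx g == 0)) GL_weight g).
  apply: eq_bigl => g; case: (boolP (g \in unitmx)) => //= ug.
  case: (eqVneq (dlsubmx g) 0) => [g0|]; last by rewrite andbF.
  move: ug; rewrite -[g]submxK g0 ublock_unitmx => /andP[uA uD].
  by rewrite invmx_ublock // !block_mxKdl !scaler0 eqxx.
rewrite big_block_mx.
transitivity (\sum_(A : 'M[F]_1 | A \in unitmx) q ^+ n * GL_weight A * GL_sum n).
  rewrite [RHS]big_mkcond; apply: eq_bigr => A _.
  rewrite (bigD1 0) //= [X in _ + X]big1 ?addr0.
    under eq_bigr do under eq_bigl do rewrite block_mxKdl eqxx andbT.
    case: ifP => [uA|uA]; first by rewrite sum_ublock // mul1n.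
    by apply: big1 => B _; rewrite big_pred0 // => D; rewrite ublock_unitmx uA.
  move=> C C0; apply: big1 => B _; rewrite big_pred0 // => D.
  by rewrite block_mxKdl (negPf C0) andbF.
rewrite -mulr_suml -mulr_sumr; congr (_ * _ * _).
rewrite /kloosterman (reindex (fun a : F => a%:M)) /=; last first.
  exists (fun A : 'M[F]_1 => A 0 0) => [a _|A _]; first by rewrite mxE mulr1n.
  by rewrite -mx11_scalar.
apply: eq_big => [a|a ua]; first by rewrite unitmxE det_scalar1 unitfE.
by rewrite /GL_weight invmx_scalar !mxtrace_scalar !mulr1n.
Qed.

(** Conjugation by diag(1, P), with P sending [c] to the first basis vector, multiplies the lower
    left columns of g and of its inverse by P. It preserves both the restriction and the weight. *)
Lemma GL_sum_fiber_pivot n (c : 'cV[F]_(1 + n)) : c != 0 ->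
  \sum_(g : 'M[F]_(1 + (1 + n)) | (g \in unitmx) &&
     (x *: dlsubmx g == y *: dlsubmx (invmx g)) && (dlsubmx g == c)) GL_weight g =
  \sum_(g : 'M[F]_(1 + (1 + n)) | (g \in unitmx) &&
     (x *: dlsubmx g == y *: dlsubmx (invmx g)) && (dlsubmx g == col_mx 1%:M 0)) GL_weight g.
Proof.
move=> /col_pivot[P uP Pc].
pose Q : 'M[F]_(1 + (1 + n)) := block_mx 1%:M 0 0 P.
have uQ : Q \in unitmx by rewrite ublock_unitmx unitmx1.
have QV : invmx Q = block_mx 1%:M 0 0 (invmx P).
  by rewrite invmx_ublock ?unitmx1 // mulmx0 mul0mx oppr0 invmx1.
have dlQ g : dlsubmx (Q *m g *m invmx Q) = P *m dlsubmx g.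
  rewrite QV -{1}[g]submxK !mulmx_block block_mxKdl.
  by rewrite !mulmx0 !mul0mx !addr0 !add0r mulmx1.
rewrite [RHS](reindex (fun g => Q *m g *m invmx Q)) /=; last first.
  exists (fun g => invmx Q *m g *m Q) => g _.
    by rewrite !mulmxA mulVmx // mul1mx mulmxKV.
  by rewrite !mulmxA mulmxV // mul1mx mulmxK.
have PI : injective (mulmx P : 'cV[F]_(1 + n) -> _) by exact: (can_inj (mulKmx uP)).
apply: eq_big => [g|g /andP[/andP[ug _] _]]; last by rewrite GL_weight_conj.
rewrite !unitmx_mul uQ unitmx_inv uQ andbT /=.
case: (boolP (g \in unitmx)) => //= ug.
have -> : invmx (Q *m g *m invmx Q) = Q *m invmx g *m invmx Q.
  by apply: invmx_right_inv; rewrite !mulmxA mulmxKV // mulmxK // mulmxV.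
by rewrite !dlQ !scalemxAr -Pc !(inj_eq PI).
Qed.

(* [g] is written in blocks of sizes 2 and m, but [dlsubmx] splits it as 1 + (1 + m):
   both index types are convertible to ['I_m.+2]. *)
Lemma pivot_fiberE m (A : 'M[F]_2) B (C : 'M[F]_(m, 2)) D :
  let g : 'M[F]_(1 + (1 + m)) := block_mx A B C D in
  (g \in unitmx) && (x *: dlsubmx g == y *: dlsubmx (invmx g))
    && (dlsubmx g == col_mx 1%:M 0)
  = [&& C == 0, A 1 0 == 1, \det A == - (y / x) & D \in unitmx].
Proof.
move=> g; apply/idP/idP.
  move=> /andP[/andP[ug /eqP cond] /eqP dlg].
  have gV : g *m invmx g = 1%:M by rewrite mulmxV.
  have [A' [B' [C' [D' gVE]]]] : exists A' B' C' D',
      invmx g = @block_mx F 2 m 2 m A' B' C' D'.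
    by do 4!eexists; exact: esym (@submxK F 2 m 2 m _).
  move: cond dlg gV; rewrite gVE => cond dlg.
  move: cond dlg; rewrite /g !dlsubmx_block_mx2 => + /[dup] dlg /(@eq_col_mx F 1 m 1) [A10 C0].
  rewrite dlg !scale_col_mx => /(@eq_col_mx F 1 m 1) [A'10 C'0].
  rewrite (@mulmx_block F 2 m 2 m 2 m) (@scalar_mx_block F 2 m 1).
  move=> /(@eq_block_mx F 2 m 2 m) [E1 _ E3 _].
  have {}A10 : A 1 0 = 1 by move/matrixP/(_ 0 0): A10; rewrite !mxE !mulr1n.
  have {}A'10 : A' 1 0 = x / y.
    move/matrixP/(_ 0 0): A'10; rewrite !mxE !mulr1n mulr1 => ->.
    by rewrite mulrC mulKf.
  have {}C'0 : col 0 C' = 0.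
    by move/esym/eqP: C'0; rewrite scaler0 scaler_eq0 (negPf y0) => /eqP.
  have colC0 k (E : 'M[F]_(k, m)) i : (E *m C') i 0 = 0.
    have -> : (E *m C') i 0 = col 0 (E *m C') i 0 by rewrite [RHS]mxE.
    by rewrite colE -mulmxA -colE C'0 mulmx0 mxE.
  have xy0 : x / y != 0 by rewrite mulf_neq0 ?invr_eq0.
  have {E3}C0 : C = 0.
    apply/matrixP => i j; have Ci0 : C i 0 = 0.
      by move/matrixP/(_ i 0): C0; rewrite !mxE.
    (* In column 0 of C A' + D C' = 0 only C_{i1} x / y survives. *)
    move/matrixP/(_ i 0): E3; rewrite mxE colC0 addr0 mulmx22E Ci0 mul0r add0r A'10.
    move/eqP; rewrite !mxE mulf_eq0 (negPf xy0) orbF => /eqP Ci1.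
    by have [->|->] := ord2P j.
  (* Column 0 of A A' + B C' = 1 gives two equations; eliminating A'_{00} from them yields det A *
     (x / y) = -1. *)
  have E10 : A 1 1 * (x / y) = - A' 0 0.
    move/matrixP/(_ 1 0): E1; rewrite mxE colC0 addr0 mulmx22E A10 A'10 mul1r !mxE /=.
    by rewrite mulr0n addrC => /eqP; rewrite addr_eq0 => /eqP.
  have E00 : A 0 0 * A' 0 0 + A 0 1 * (x / y) = 1.
    by move/matrixP/(_ 0 0): E1; rewrite mxE colC0 addr0 mulmx22E A'10 !mxE /=.
  move: ug; rewrite /g C0 (@ublock_unitmx F 2 m) => /andP[uA uD].
  rewrite eqxx A10 eqxx uD andbT /=; apply/eqP/(mulIf xy0).
  rewrite det_mx22 A10 mulr1 mulrBl -mulrA E10 mulrN -opprD E00 mulNr.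
  by rewrite mulrA divfK // divff.
case/and4P => /eqP C0 /eqP A10 /eqP dA uD.
have dA0 : \det A != 0 by rewrite dA oppr_eq0 mulf_neq0 ?invr_eq0.
have uA : A \in unitmx by rewrite unitmxE unitfE.
have -> : g \in unitmx by rewrite /g C0 (@ublock_unitmx F 2 m) uA.
rewrite /g C0 (@invmx_ublock F 2 m) // !dlsubmx_block_mx2 A10.
(* Conversely, the adjugate formula gives the inverse of A the lower left entry -1 / det A = x /
   y. *)
rewrite invmx22 // dA invrN invf_div !mxE A10 mulr0n sub0r mulrNN mulr1.
rewrite !scale_col_mx col0 !scaler0 !scale_scalar_mx mulr1 [y * _]mulrC divfK //.
by rewrite !eqxx.
Qed.

(** Here tr(A^-1) = tr A / det A = -(x / y) tr A, so the two terms in the argument of [lam]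
    cancel. *)
Lemma GL_weight_det (A : 'M[F]_2) : \det A = - (y / x) -> GL_weight A = 1.
Proof.
move=> dA; have dA0 : \det A != 0 by rewrite dA oppr_eq0 mulf_neq0 ?invr_eq0.
rewrite /GL_weight mxtrace_invmx22 // dA invrN invf_div -lam0; congr lam.
by field.
Qed.

(** The diagonal entries are free, and the determinant then forces the upper right entry to be
    A_{00} A_{11} + y / x. *)
Lemma card_pivot_block :
  #|[pred A : 'M[F]_2 | (A 1 0 == 1) && (\det A == - (y / x))]| = (#|F| ^ 2)%N.
Proof.
pose h (p : F * F) : 'M[F]_2 := \matrix_(i, j)
  if i == 0 then if j == 0 then p.1 else p.1 * p.2 + y / x else if j == 0 then 1 else p.2.
have hE p : [/\ h p 0 0 = p.1, h p 0 1 = p.1 * p.2 + y / x, h p 1 0 = 1 & h p 1 1 = p.2].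
  by rewrite !mxE.
have hI : injective h.
  by move=> [a b] [c d] E; have [/= Ea _ _ Eb] := hE (a, b); have := hE (c, d);
    rewrite -E Ea Eb /= => -[-> _ _ ->].
rewrite expnS expn1 -card_prod -(card_codom hI); apply: eq_card => A.
rewrite !inE det_mx22; apply/idP/codomP => [/andP[/eqP A10 /eqP dA]|[p ->]].
  exists (A 0 0, A 1 1); apply/matrixP => i j.
  have [/= h00 h01 h10 h11] := hE (A 0 0, A 1 1).
  have [->|->] := ord2P i; have [->|->] := ord2P j => //.
    by rewrite h01 -[y / x]opprK -dA A10 mulr1 opprB addrC subrK.
  by rewrite h10.
by have [-> -> -> ->] := hE p; rewrite eqxx /= mulr1 opprD addNKr.
Qed.

(** There are q^2 blocks A, each of weight 1, and q^(2n) blocks B; the sum over D is [GL_sum n]. *)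
Lemma GL_sum_pivot n :
  \sum_(g : 'M[F]_(1 + (1 + n)) | (g \in unitmx) &&
     (x *: dlsubmx g == y *: dlsubmx (invmx g)) && (dlsubmx g == col_mx 1%:M 0)) GL_weight g
  = q ^+ (2 * n + 2) * GL_sum n.
Proof.
rewrite (@big_block_mx F _ 2 n).
transitivity (\sum_(A : 'M[F]_2 | (A 1 0 == 1) && (\det A == - (y / x)))
   q ^+ (2 * n) * GL_sum n).
  rewrite [RHS]big_mkcond; apply: eq_bigr => A _.
  rewrite (bigD1 0) //= [X in _ + X]big1 ?addr0.
    case: ifP => [/andP[A10 dA]|AN]; last first.
      by apply: big1 => B _; apply: big_pred0 => D; rewrite pivot_fiberE eqxx /= andbA AN.
    have uA : A \in unitmx.
      by rewrite unitmxE unitfE (eqP dA) oppr_eq0 mulf_neq0 ?invr_eq0.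
    have := sum_ublock n uA; rewrite GL_weight_det ?(eqP dA) // mulr1 => <-.
    apply: eq_bigr => B _; apply: eq_bigl => D.
    by rewrite pivot_fiberE A10 dA eqxx (@ublock_unitmx F 2 n) uA.
  move=> C C0; apply: big1 => B _; apply: big_pred0 => D.
  by rewrite pivot_fiberE (negPf C0).
rewrite sumr_const card_pivot_block -[_ *+ _]mulr_natl natrX mulrA -exprD.
by rewrite addnC.
Qed.

Lemma GL_sum_rec n :
  GL_sum n.+2 = q ^+ n.+1 * kloosterman lam x y * GL_sum n.+1
    + q ^+ (2 * n + 2) * (q ^+ n.+1 - 1) * GL_sum n.
Proof.
rewrite (GL_sum_restrict n.+1) (bigID (fun g => dlsubmx g == 0)) /=.
rewrite GL_sum_parabolic; congr (_ + _).
(* The remaining g are sorted by their nonzero column c; the q^(n+1) - 1 fibers all have the same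
   sum. *)
rewrite (partition_big (fun g => dlsubmx g) (fun c => c != 0)) /=; last by move=> g /andP[].
transitivity (\sum_(c : 'cV[F]_(1 + n) | c != 0) q ^+ (2 * n + 2) * GL_sum n).
  apply: eq_bigr => c c0; rewrite -(GL_sum_pivot n) -(GL_sum_fiber_pivot c0).
  by apply: eq_bigl => g; case: (eqVneq (dlsubmx g) c) => [->|]; rewrite ?andbF // c0 !andbT.
rewrite sumr_const -[_ *+ _]mulr_natl mulrCA mulrA; congr (_ * _ * _).
have -> : #|[pred c : 'cV[F]_(1 + n) | c != 0]| = (#|F| ^ n.+1 - 1)%N.
  transitivity #|predC1 (0 : 'cV[F]_(1 + n))|; first by apply: eq_card => c; rewrite !inE.
  by rewrite cardC1 card_mx muln1 subn1.
by rewrite natrB ?natrX // expn_gt0 ltnW // finNzRing_gt1.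
Qed.

Lemma GL_sum0 : GL_sum 0 = 1.
Proof.
rewrite /GL_sum (big_pred1 1%:M) => [|g].
  by rewrite /GL_weight /mxtrace !big_ord0 !mulr0 addr0 lam0.
by rewrite unitmxE det_mx00 unitr1 [g]flatmx0 [1%:M]flatmx0 /= eqxx.
Qed.

(** In size 1 the lower left column is empty, so every g falls in the parabolic case. *)
Lemma GL_sum1 : GL_sum 1 = kloosterman lam x y.
Proof.
rewrite (GL_sum_restrict 0).
rewrite (eq_bigl (fun g => (g \in unitmx) &&
     (x *: dlsubmx g == y *: dlsubmx (invmx g)) && (dlsubmx g == 0))) => [|g].
  by rewrite GL_sum_parabolic GL_sum0 mulr1 mul1r.
by rewrite [dlsubmx g]flatmx0 eqxx andbT.
Qed.

End GLsum.

(** * Coefficients of the partial products and their limits *)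

Lemma coef_comp_scaleX (R : comNzRingType) (p : {poly R}) a n :
  (p \Po (a *: 'X))`_n = a ^+ n * p`_n.
Proof.
rewrite comp_polyE coef_sum.
under eq_bigr do rewrite exprZn scalerA coefZ coefXn.
case: (ltnP n (size p)) => np.
  rewrite (bigD1 (Ordinal np)) //= eqxx mulr1 mulrC big1 ?addr0 // => i.
  by rewrite -val_eqE /= eq_sym => /negPf->; rewrite mulr0.
rewrite nth_default // mulr0 big1 // => i _.
by rewrite gtn_eqF ?mulr0 // (leq_trans (ltn_ord i)).
Qed.

Lemma coef_quad_mul (R : comNzRingType) (p : {poly R}) a b n :
  ((1 + a *: 'X + b *: 'X ^+ 2) * p)`_n.+2 = p`_n.+2 + a * p`_n.+1 + b * p`_n.
Proof. by rewrite !mulrDl mul1r -!scalerAl expr2 -mulrA !coefD !coefZ !coefXM. Qed.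

Lemma coef_quad_mul1 (R : comNzRingType) (p : {poly R}) a b :
  ((1 + a *: 'X + b *: 'X ^+ 2) * p)`_1 = p`_1 + a * p`_0.
Proof.
by rewrite !mulrDl mul1r -!scalerAl expr2 -mulrA !coefD !coefZ !coefXM /= mulr0 addr0.
Qed.

Section TruncProd.
Variables (F : finFieldType) (lam : F -> algC) (x y : F).
Notation q := (#|F|%:R : algC).
Notation K := (kloosterman lam x y).
Notation T N n := ((trunc_prod lam x y N)`_n).

Let q0 : q != 0 := card_field_neq0 F.

(** Replacing u by q u turns factor i into factor i - 1, so the product telescopes; 1 + K u + q u^2
    is the factor of index 0. *)
Lemma trunc_prod_shift N :
  (1 + (K / q ^+ N) *: 'X + (q / q ^+ (2 * N)) *: 'X ^+ 2) *
    (trunc_prod lam x y N \Po (q *: 'X)) =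
  (1 + K *: 'X + q *: 'X ^+ 2) * trunc_prod lam x y N.
Proof.
rewrite mulrC; elim: N => [|N IH].
  by rewrite /trunc_prod big_geq // comp_polyC muln0 !expr0 !divr1 mulrC.
have E : trunc_prod lam x y N.+1 = trunc_prod lam x y N *
    (1 + (K / q ^+ N.+1) *: 'X + (q / q ^+ (2 * N.+1)) *: 'X ^+ 2).
  by rewrite /trunc_prod big_nat_recr.
rewrite {}E mulrA -{}IH comp_polyM; congr (_ * _ * _).
rewrite !comp_polyD comp_polyC !comp_polyZ rmorphXn /= comp_polyX.
rewrite exprZn !scalerA; congr (1 + _ *: _ + _ *: _).
  by rewrite exprS; field; rewrite q0 expf_neq0.
by rewrite mulnS !exprS; field; rewrite q0 expf_neq0.
Qed.

Lemma trunc_prod_coef0 N : T N 0 = 1.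
Proof.
rewrite -horner_coef0 /trunc_prod horner_prod big1 // => i _.
by rewrite !hornerD !hornerZ hornerXn hornerX hornerC expr0n !mulr0 !addr0.
Qed.

Lemma trunc_prod_coef1 N : (q - 1) * T N 1 = K * (1 - q ^- N).
Proof.
have /(congr1 (fun p : {poly _} => p`_1)) := trunc_prod_shift N.
rewrite !coef_quad_mul1 !coef_comp_scaleX trunc_prod_coef0.
rewrite expr1 expr0 !mulr1 => E.
by rewrite mulrBl mul1r mulrBr mulr1; apply/eqP; rewrite subr_eq addrAC [K + _]addrC -E addrK.
Qed.

(** Comparison of coefficients of u^(n+2) in the functional equation, arranged so that N enters the
    multipliers only through q^-N, which tends to 0. *)
Lemma trunc_prod_coef2 N n : (q ^+ n.+2 - 1) * T N n.+2 =
  K * (1 - q ^+ n.+1 * q ^- N) * T N n.+1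
  + q * (1 - q ^+ n * (q ^- N) ^+ 2) * T N n.
Proof.
have /(congr1 (fun p : {poly _} => p`_n.+2)) := trunc_prod_shift N.
rewrite !coef_quad_mul !coef_comp_scaleX.
rewrite [(2 * N)%N]mulnC exprM => /eqP; rewrite -subr_eq0 => /eqP E.
apply/eqP; rewrite -subr_eq0 -[X in _ == X]E; apply/eqP.
have := expf_neq0 N q0; move: (q ^+ N) (T N n) (T N n.+1) (T N n.+2) K => z ? ? ? ? z0.
by field.
Qed.

Lemma cvg_invX : (fun N : nat => (q ^- N : algC^o)) @ \oo --> (0 : algC^o).
Proof.
apply/cvgrPdist_lt => e e0.
have q_gt0 : 0 < q by rewrite lt0r q0 ler0n.
have ie0 : 0 <= e^-1 by rewrite invr_ge0 ltW.
near=> N.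
rewrite sub0r normrN ger0_norm ?invr_ge0 ?exprn_ge0 ?ler0n //.
rewrite invf_plt ?posrE ?exprn_gt0 //.
(* For N beyond an Archimedean bound of 1 / e, q^N > N gives q^N > 1 / e. *)
apply: lt_le_trans (archi_boundP ie0) _.
rewrite -natrX ler_nat; apply: leq_trans (ltnW (ltn_expl N (finNzRing_gt1 F))).
by near: N; exact: nbhs_infty_ge.
Unshelve. all: by end_near. Qed.

Lemma cvg_trunc_prod (c : nat -> algC) :
  c 0%N = 1 -> (q - 1) * c 1%N = K ->
  (forall n, (q ^+ n.+2 - 1) * c n.+2 = K * c n.+1 + q * c n) ->
  forall n, (fun N : nat => (T N n : algC^o)) @ \oo --> (c n : algC^o).
Proof.
move=> c0 c1 c2 n.
have qn0 := card_field_pow_sub1_neq0 F.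
(* The recurrence has order two, so the induction carries two consecutive coefficients. *)
suff [] : (fun N : nat => (T N n : algC^o)) @ \oo --> (c n : algC^o) /\
    (fun N : nat => (T N n.+1 : algC^o)) @ \oo --> (c n.+1 : algC^o) by [].
elim: n => [|n [IHn IHn1]]; split=> //.
- under eq_fun do rewrite trunc_prod_coef0.
  by rewrite c0; exact: cvg_cst.
- have -> : c 1%N = (q - 1)^-1 * (K * (1 - 0)).
    by rewrite subr0 mulr1 -c1 mulKf // (qn0 0%N).
  have -> : (fun N => T N 1) = (fun N => (q - 1)^-1 * (K * (1 - q ^- N))).
    by apply/funext => N; rewrite -trunc_prod_coef1 mulKf // (qn0 0%N).
  apply: cvgMl_tmp; apply: cvgMl_tmp; apply: cvgB; first exact: cvg_cst.
  exact: cvg_invX.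
(* The recurrence of [c] is written with 0 in place of q^-N, to match the limit term by term. *)
- have -> : c n.+2 = (q ^+ n.+2 - 1)^-1 *
      (K * (1 - q ^+ n.+1 * 0) * c n.+1 + q * (1 - q ^+ n * (0 * 0)) * c n).
    by rewrite !mulr0 subr0 !mulr1 -c2 mulKf.
  have -> : (fun N => T N n.+2) = (fun N => (q ^+ n.+2 - 1)^-1 *
      (K * (1 - q ^+ n.+1 * q ^- N) * T N n.+1
       + q * (1 - q ^+ n * (q ^- N * q ^- N)) * T N n)).
    by apply/funext => N; rewrite -expr2 -trunc_prod_coef2 mulKf.
  apply: cvgMl_tmp; apply: cvgD; apply: cvgM => //; apply: cvgMl_tmp;
    apply: cvgB; try exact: cvg_cst; apply: cvgMl_tmp; try apply: cvgM;
    exact: cvg_invX.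
Qed.

End TruncProd.

(** * The left-hand coefficients satisfy the limiting recurrence *)

Lemma lhs_coefE (F : finFieldType) (lam : F -> algC) (x y : F) n :
  additive_character lam -> lhs_coef lam x y n = GL_sum lam x y n / (GL_card F n)%:R.
Proof.
case: n => [|n] lamP; last by rewrite mulrC.
by rewrite GL_sum0 // GL_card0 invr1 mulr1.
Qed.

(** [GL_sum_rec] divided by |GL(n+2, q)|: the order recurrence, applied once and twice, cancels
    q^(n+1) in the first term and leaves q^(2n+2) / q^(2n+1) = q in the second. *)
Lemma lhs_coef_rec (F : finFieldType) (lam : F -> algC) (x y : F) n :
  additive_character lam -> nontrivial_character lam -> x != 0 -> y != 0 ->
  (#|F|%:R ^+ n.+2 - 1) * lhs_coef lam x y n.+2 =
  kloosterman lam x y * lhs_coef lam x y n.+1 + #|F|%:R * lhs_coef lam x y n.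
Proof.
move=> lamP lam_neq1 x0 y0; rewrite !lhs_coefE // (GL_sum_rec lamP lam_neq1 x0 y0).
rewrite !GL_card_recR; have := GL_card_neq0 F n.
have := card_field_pow_sub1_neq0 F n.+1; have := card_field_pow_sub1_neq0 F n.
have := card_field_neq0 F; rewrite exprD mulnC exprM !(exprS _ n.+1) !(exprS _ n).
move: (#|F|%:R : algC) => q q0; have := expf_neq0 n q0.
move: (q ^+ n) => z z0 d1 d2 g0; field.
by rewrite q0 z0 d1 d2 g0.
Qed.

Unset Implicit Arguments.

(* The infinite product is understood coefficientwise: for each n, the
   coefficient of u^n in the partial products prod_{i=1}^N converges (N -> oo)
   to the coefficient of u^n of the left-hand side. *)
Theorem theorem2 (F : finFieldType) (lam : F -> algC) (x y : F) :
  additive_character lam -> nontrivial_character lam ->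
  x != 0 -> y != 0 ->
  forall n : nat,
    (fun N : nat => ((trunc_prod lam x y N)`_n : algC^o)) @ \oo -->
      (lhs_coef lam x y n : algC^o).
Proof.
move=> lamP lam_neq1 x0 y0; apply: cvg_trunc_prod => //; last first.
  by move=> n; exact: lhs_coef_rec.
(* The coefficient of u is K / (q - 1), since |GL(1, q)| = q - 1. *)
rewrite lhs_coefE // (GL_sum1 x y lamP lam_neq1) GL_card_recR GL_card0 expr0 mul1r mulr1.
by rewrite mulrC divfK // (card_field_pow_sub1_neq0 F 0).
Qed.
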